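(* Let $V$ be a vector space. Then: (i) $\mathcal{HL}(\mathcal{F})\leq\mathcal{L}(\mathcal{F})$ for every $\mathcal{F}\subseteq V$; (ii) for every successor cardinal $\kappa\leq(\dim V)^+$ there is $\mathcal{F}\subseteq V$ with $\mathcal{HL}(\mathcal{F})=\mathcal{L}(\mathcal{F})=\kappa$; (iii) for every $\lambda,\kappa\leq(\dim V)^+$ such that $\lambda^+<\kappa$ there is $\mathcal{F}\subseteq V$ with $\mathcal{HL}(\mathcal{F})=\lambda^+$ and $\mathcal{L}(\mathcal{F})=\kappa$; (iv) $\mathcal{HL}(\mathcal{F})$ is a successor cardinal (for $\mathcal{F}\subseteq V$).
   Context: Here $\lambda,\kappa$ denote cardinal numbers; $\lambda^+$ denotes the least cardinal greater than $\lambda$, and a successor cardinal is one of the form $\lambda^+$. For a vector space $V$ and $\mathcal{F}\subseteq V$: - $\mathcal{F}$ is $\lambda$-lineable if there is a linear subspace $W$ of $V$ with $W\subseteq\mathcal{F}\cup\{0\}$ and $\dim W=\lambda$. - The lineability number is $\mathcal{L}(\mathcal{F})=\min\{\lambda:\mathcal{F}\text{ is not }\lambda\text{-lineable}\}$, the minimum being over cardinals $\lambda$. - The homogeneous lineability number $\mathcal{HL}(\mathcal{F})$ is the minimum of the set consisting of $|V|^+$ and of all cardinals $\lambda$ such that there is a linear space $Y\subseteq\mathcal{F}\cup\{0\}$ with $\dim Y<\lambda$ which cannot be extended to a linear space $X$ with $Y\subseteq X\subseteq\mathcal{F}\cup\{0\}$ and $\dim X=\lambda$.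
   Formalization: In (iii) it is additionally assumed that λ > 0 and, when dim V is finite, that κ ≤ dim V; in the excluded cases (λ = 0, or dim V finite and κ = dim V + 1) no such F exists, so (iii) is false there as stated. *)

(* Defs.v *)
From HB Require Import structures.
From mathcomp Require Import all_boot all_order all_algebra.
From mathcomp Require Import mathcomp_extra boolp classical_sets functions.
From mathcomp Require Import cardinality.

Set Implicit Arguments.
Unset Strict Implicit.
Unset Printing Implicit Defensive.
Import GRing.Theory.
Local Open Scope classical_set_scope.
Local Open Scope card_scope.
Local Open Scope ring_scope.

(* A cardinal is an equipotence class of types, so that Leibniz equality of   *)
(* cardinals is equipotence of their members (cardinal_ofP).                  *)
(* Pitfall: equipping cardinal with an eqType/choiceType/orderType instance,  *)
(* or forming [set cardinal], would push the types being counted into a       *)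
(* universe strictly below that of the library's sets.                        *)
Record cardinal := Cardinal {
  cardinal_class : Type -> Prop ;
  cardinal_classP : exists T : Type,
    cardinal_class = (fun U : Type => is_true ([set: U] #= [set: T])) }.

Definition cardinal_of (T : Type) : cardinal :=
  @Cardinal (fun U : Type => [set: U] #= [set: T]) (ex_intro _ T erefl).

Definition cardinal_le (k m : cardinal) : Prop :=
  exists T U : Type,
    [/\ k = cardinal_of T, m = cardinal_of U & [set: T] #<= [set: U]].

Definition cardinal_lt (k m : cardinal) : Prop := cardinal_le k m /\ k <> m.

Declare Scope cardinal_scope.
Delimit Scope cardinal_scope with cardinal.
Bind Scope cardinal_scope with cardinal.
Notation "k <= m" := (cardinal_le k m) : cardinal_scope.
Notation "k < m" := (cardinal_lt k m) : cardinal_scope.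

Lemma cardinal_class_inj (k m : cardinal) :
  cardinal_class k = cardinal_class m -> k = m.
Proof.
case: k m => [C CP] [D DP] /= CD; rewrite -CD in DP *.
by congr Cardinal; exact: Prop_irrelevance.
Qed.

Lemma cardinalP (k : cardinal) : exists T : Type, k = cardinal_of T.
Proof.
by have [T e] := cardinal_classP k; exists T; exact: cardinal_class_inj.
Qed.

Lemma cardinal_ofP (T U : Type) :
  cardinal_of T = cardinal_of U <-> [set: T] #= [set: U].
Proof.
split=> [/(congr1 cardinal_class) /= e|TU].
  have /= := card_eqxx [set: T].
  by rewrite -[is_true _]/((fun W : Type => is_true ([set: W] #= [set: T])) T) e.
apply: cardinal_class_inj; apply/funext => W; apply/propext.
by split=> h; apply: card_eq_trans h _; rewrite // card_eq_sym.
Qed.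

Lemma cardinal_leP (T U : Type) :
  (cardinal_of T <= cardinal_of U)%cardinal <-> [set: T] #<= [set: U].
Proof.
split=> [[T' [U' [/cardinal_ofP e1 /cardinal_ofP e2 le]]]|le].
  move: e1 e2; rewrite !card_eq_le => /andP[a _] /andP[_ b].
  exact: card_le_trans (card_le_trans a le) b.
by exists T, U.
Qed.

(* Some cardinal satisfying P; the dummy 0 if there is none. *)
Definition cardinal_choose (P : cardinal -> Prop) : cardinal :=
  match pselect (exists k, P k) with
  | left ex => proj1_sig (cid ex)
  | right _ => cardinal_of void
  end.

(* Cardinals being well-ordered, this is the least element of S whenever S is *)
(* not empty.                                                                 *)
Definition cardinal_min (S : cardinal -> Prop) : cardinal :=
  cardinal_choose (fun k => S k /\ forall m, S m -> (k <= m)%cardinal).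

Definition cardinal_succ (k : cardinal) : cardinal :=
  cardinal_min (fun m => (k < m)%cardinal).

Definition successor_cardinal (k : cardinal) : Prop :=
  exists l, k = cardinal_succ l.

Section Lineability.
Variables (K : fieldType) (V : lmodType K).
Implicit Types (B W F : set V) (k : cardinal).

Definition lin_subspace W : Prop := GRing.submod_closed [pred v | v \in W].

Definition lin_indep B : Prop :=
  forall (s : seq V) (c : V -> K), uniq s -> [set` s] `<=` B ->
    \sum_(v <- s) c v *: v = 0 -> forall v, v \in s -> c v = 0.

Definition lin_span B : set V :=
  [set u | exists (s : seq V) (c : V -> K),
     [set` s] `<=` B /\ u = \sum_(v <- s) c v *: v].

Definition lin_basis W B : Prop := lin_indep B /\ lin_span B = W.

(* All Hamel bases of a subspace have the same cardinality, so the choice is  *)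
(* immaterial.                                                                *)
Definition lin_dim W : cardinal :=
  cardinal_choose (fun k =>
    exists2 B, lin_basis W B & k = cardinal_of (set_type B)).

Definition lineable F k : Prop :=
  exists W, [/\ lin_subspace W, W `<=` F `|` [set 0] & lin_dim W = k].

Definition lineability_number F : cardinal :=
  cardinal_min (fun k => ~ lineable F k).

Definition nonextendable_at F k : Prop :=
  exists Y, [/\ lin_subspace Y, Y `<=` F `|` [set 0],
    (lin_dim Y < k)%cardinal &
    ~ exists X, [/\ lin_subspace X, Y `<=` X, X `<=` F `|` [set 0] &
        lin_dim X = k]].

Definition homogeneous_lineability_number F : cardinal :=
  cardinal_min
    (fun k => k = cardinal_succ (cardinal_of V) \/ nonextendable_at F k).

End Lineability.

(* Main.v *)
(* HL F is the least (dim Z)^+ over the maximal subspaces Z of F u {0}: if Y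
   witnesses non-extendability at k, a maximal Z containing Y (Zorn) has
   dimension < k, since otherwise a subspace of dimension k would lie between Y
   and Z. Hence HL F is a successor. As {0} cannot be extended to dimension
   L F, HL F <= L F. For the constructions, F is a union of subspaces such that
   every subspace inside F lies in one of them: a single subspace for (ii), two
   subspaces for (iii) when k is a successor, and when k is a limit the spans of
   intervals of a suitably well-ordered linearly independent set. *)
Require Import Defs.
From HB Require Import structures.
From mathcomp Require Import all_boot all_order all_algebra.
From mathcomp Require Import mathcomp_extra boolp classical_sets functions.
From mathcomp Require Import cardinality wochoice.

Set Implicit Arguments.
Unset Strict Implicit.
Unset Printing Implicit Defensive.
Import GRing.Theory.
Local Open Scope classical_set_scope.
Local Open Scope card_scope.

(** * Cardinals *)

(** For a limit [k], lineability number [k] asks for subspaces of every dimension below [k] in F and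
    none of dimension [k]. A union of one or two subspaces only yields successors, and a chain of
    subspaces with dimensions cofinal in [k] has as union a subspace of dimension at least [k]. So
    the family has to be large and not nested. Moreover K may be finite, and a subspace over a
    finite field can be a finite union of proper subspaces, so counting cannot confine a subspace of
    F to one member of the family. An order does it instead: as the left end of an interval moves to
    the right, its right end never moves back. Hence a vector in the span of some interval also lies
    in the span of the interval that starts at the least basis element occurring in it. *)

(** [Zorn_bigcup] also tests the empty chain. Applying it to the sets whose union with [A0]
    satisfies [P] turns that case into [P A0], and puts the maximal set above [A0]. *)
Lemma Zorn_above (T : Type) (P : set (set T)) (A0 : set T) : P A0 ->
  (forall F : set (set T), F `<=` P -> total_on F subset -> F !=set0 ->
    P (\bigcup_(X in F) X)) ->
  exists A, [/\ P A, A0 `<=` A & forall B, A `<=` B -> P B -> B `<=` A].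
Proof.
move=> PA0 chainP.
have [F FP totF|A [PA maxA]] := @Zorn_bigcup T [set X | P (A0 `|` X)].
  have [[X FX]|F0] := pselect (F !=set0); last first.
    rewrite /= (_ : \bigcup_(X in F) X = set0) ?setU0//.
    by rewrite -subset0 => x [X FX]; case: F0; exists X.
  rewrite /= (_ : _ `|` _ = \bigcup_(Y in [set A0 `|` X | X in F]) Y).
    apply: chainP => [_ [Y FY <-]|_ _ [Y FY <-] [Z FZ <-]|]; first exact: FP.
      by have [YZ|ZY] := totF _ _ FY FZ; [left|right]; exact: setUS.
    by exists (A0 `|` X); exists X.
  apply/seteqP; split=> [x [A0x|[Y FY Yx]]|x [_ [Y FY <-]] [A0x|Yx]].
  - by exists (A0 `|` X); [exists X|left].
  - by exists (A0 `|` Y); [exists Y|right].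
  - by left.
  - by right; exists Y.
exists (A0 `|` A); split=> // B AB PB x Bx.
have AB' : A `<=` B by move=> y Ay; apply: AB; right.
right; apply: contrapT => nAx; apply: (maxA B).
  by split=> // BA; apply: nAx; exact: BA.
by rewrite /= (_ : A0 `|` B = B)//; apply/setUidPr => y A0y; apply: AB; left.
Qed.

Lemma chain_seq (T : eqType) (F : set (set T)) (s : seq T) :
  total_on F subset -> F !=set0 -> [set` s] `<=` \bigcup_(X in F) X ->
  exists2 X, F X & [set` s] `<=` X.
Proof.
move=> totF [X0 FX0]; elim: s => [|x s IH] sF; first by exists X0.
have [|X FX sX] := IH; first by move=> y ys; apply: sF; rewrite /= inE ys orbT.
have [|Y FY Yx] := sF x; first by rewrite /= mem_head.
have [XY|YX] := totF _ _ FX FY.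
  by exists Y => // y /=; rewrite inE => /predU1P[->//|/sX/XY].
by exists X => // y /=; rewrite inE => /predU1P[->|/sX//]; exact: YX.
Qed.

(** Zorn's lemma yields maximal relations rather than functions; choice turns them into injections
    here, once and for all. An empty [B] is set apart because a total function needs the default
    value [b0]. *)
Lemma card_le_rel (T U : Type) (A : set T) (B : set U) (R : T -> U -> Prop) :
  (forall a, A a -> exists2 b, B b & R a b) ->
  (forall a a' b, A a -> A a' -> B b -> R a b -> R a' b -> a = a') ->
  A #<= B.
Proof.
move=> totR injR; have [[b0 Bb0]|B0] := pselect (B !=set0); last first.
  rewrite (_ : A = set0)// -subset0 => a /totR[b Bb _].
  by case: B0; exists b.
have /choice[f fP] : forall a, exists b, A a -> B b /\ R a b.
  move=> a; have [/totR[b Bb Rab]|nAa] := pselect (A a); first by exists b.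
  by exists b0.
have finj : {in A &, injective f}.
  move=> a a' /set_mem Aa /set_mem Aa' fE.
  have [Bb Rb] := fP _ Aa; have [_] := fP _ Aa'; rewrite -fE.
  exact: injR Rb.
rewrite -(card_le_eql (inj_card_eq finj)); apply: subset_card_le.
by move=> _ [a Aa <-]; have [] := fP _ Aa.
Qed.

Lemma card_le_relP (T U : Type) (A : set T) (B : set U) : A #<= B ->
  exists R : T -> U -> Prop,
    [/\ forall a b, R a b -> A a /\ B b,
        forall a, A a -> exists b, R a b,
        forall a b b', R a b -> R a b' -> b = b' &
        forall a a' b, R a b -> R a' b -> a = a'].
Proof.
move=> /card_leP[f].
exists (fun a b => exists2 x : A, a = set_val x & b = set_val (f x)).
split=> [_ _ [x -> ->]|a Aa|_ _ _ [x -> ->] [y /val_inj <- ->]//|].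
- by split; exact: set_valP.
- exists (set_val (f (SigSub (mem_set Aa)))).
  by exists (SigSub (mem_set Aa)).
- move=> _ _ _ [x -> ->] [y -> /val_inj fxy].
  by congr set_val; apply: (@inj _ _ _ f) => //; exact: mem_set.
Qed.

(* A maximal partial injection of B into D is total on B or onto D. *)
Lemma card_le_extend (T U : Type) (A B : set T) (D : set U) :
  A `<=` B -> A #<= D ->
  exists C, [/\ A `<=` C, C `<=` B, C #<= D & C = B \/ D #<= C].
Proof.
move=> AB /card_le_relP[R0 [R0D R0t R0f R0i]].
pose P (G : set (T * U)) := [/\ forall a b, G (a, b) -> B a /\ D b,
  forall a b b', G (a, b) -> G (a, b') -> b = b' &
  forall a a' b, G (a, b) -> G (a', b) -> a = a'].
have [||G [[GD Gf Gi] R0G maxG]] :=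
    @Zorn_above _ P [set p | R0 p.1 p.2].
- split=> /= [a b /R0D[/AB]//|a b b'|a a' b]; [exact: R0f|exact: R0i].
- move=> F FP totF _; split=> [a b [X /FP[XD _ _] /XD]//|a b b'|a a' b].
    move=> [X FX Xb] [Y FY Yb]; have [XY|YX] := totF _ _ FX FY.
      by have [_ Yf _] := FP _ FY; apply: Yf Yb; exact: XY.
    by have [_ Xf _] := FP _ FX; apply: Xf Xb _; exact: YX.
  move=> [X FX Xb] [Y FY Yb]; have [XY|YX] := totF _ _ FX FY.
    by have [_ _ Yi] := FP _ FY; apply: Yi Yb; exact: XY.
  by have [_ _ Xi] := FP _ FX; apply: Xi Xb _; exact: YX.
exists [set a | exists b, G (a, b)]; split.
- by move=> a /R0t[b Rab]; exists b; exact: (R0G (a, b)).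
- by move=> a [b /GD[]].
- apply: (@card_le_rel _ _ _ _ (fun a b => G (a, b))).
    by move=> a [b Gab]; exists b => //; have [] := GD _ _ Gab.
  by move=> a a' b _ _ _; exact: Gi.
- have [CB|/existsNP[a /not_implyP[Ba nCa]]] :=
      pselect (forall a, B a -> exists b, G (a, b)).
    by left; apply/seteqP; split=> [a [b /GD[]]//|].
  right; apply: (@card_le_rel _ _ _ _ (fun b a => G (a, b))); last first.
    by move=> b b' a' _ _ _; exact: Gf.
  move=> d Dd; apply: contrapT => nd.
  have nGd a' : ~ G (a', d) by move=> Gd; apply: nd; exists a' => //; exists d.
  suff PG' : P (G `|` [set (a, d)]).
    by apply: nCa; exists d; apply: (maxG _ _ PG'); [move=> p; left|right].
  split=> [a' b [/GD//|[-> ->]//]|a' b b'|a' a'' b].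
  + move=> [Gb|[aE bE]] [Gb'|[aE' bE']]; first exact: Gf Gb Gb'.
    * by case: nCa; exists b; rewrite -aE'.
    * by case: nCa; exists b'; rewrite -aE.
    * by rewrite bE bE'.
  + move=> [Gb|[aE bE]] [Gb'|[aE' bE']]; first exact: Gi Gb Gb'.
    * by case: (nGd a'); rewrite -bE'.
    * by case: (nGd a''); rewrite -bE.
    * by rewrite aE aE'.
Qed.

Lemma card_le_total (T U : Type) (A : set T) (B : set U) :
  A #<= B \/ B #<= A.
Proof.
have [C [_ CA CB [<-|BC]]] := card_le_extend (@sub0set _ A) (card_ge0 T B).
  by left.
by right; apply: card_le_trans BC _; exact: subset_card_le.
Qed.

Lemma card_intermediate (T U : Type) (A B : set T) (D : set U) :
  A `<=` B -> A #<= D -> D #<= B ->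
  exists C, [/\ A `<=` C, C `<=` B & C #= D].
Proof.
move=> AB AD DB; have [C [AC CB CD CBD]] := card_le_extend AB AD.
exists C; split=> //; rewrite card_eq_le CD /=.
by case: CBD => // ->.
Qed.

Lemma cardinal_of_set (k : cardinal) : exists (T : Type) (A : set T),
  k = cardinal_of A.
Proof.
have [T ->] := cardinalP k; exists T, [set: T].
by apply/cardinal_ofP; rewrite card_esym.
Qed.

Lemma cardinal_of_leP (T U : Type) (A : set T) (B : set U) :
  (cardinal_of A <= cardinal_of B)%cardinal <-> A #<= B.
Proof.
by rewrite cardinal_leP (card_le_eql (card_setT A)) (card_le_eqr (card_setT B)).
Qed.

Lemma cardinal_of_eqP (T U : Type) (A : set T) (B : set U) :
  cardinal_of A = cardinal_of B <-> A #= B.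
Proof.
by rewrite cardinal_ofP (card_eql (card_setT A)) (card_eqr (card_setT B)).
Qed.

Local Open Scope cardinal_scope.

Lemma cardinal_le_refl k : k <= k.
Proof. by have [T ->] := cardinalP k; apply/cardinal_leP. Qed.
#[local] Hint Resolve cardinal_le_refl : core.

Lemma cardinal_le_trans m k n : k <= m -> m <= n -> k <= n.
Proof.
have [T ->] := cardinalP k; have [U ->] := cardinalP m.
have [W ->] := cardinalP n.
by move=> /cardinal_leP TU /cardinal_leP UW;
  apply/cardinal_leP/card_le_trans/UW.
Qed.

Lemma cardinal_le_anti k m : k <= m -> m <= k -> k = m.
Proof.
have [T ->] := cardinalP k; have [U ->] := cardinalP m.
by move=> /cardinal_leP TU /cardinal_leP UT;
  apply/cardinal_ofP/Cantor_Bernstein.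
Qed.

Lemma cardinal_leNgt k m : k <= m <-> ~ m < k.
Proof.
split=> [km [mk nkm]|nmk]; first by apply: nkm; exact: cardinal_le_anti.
have [T kE] := cardinalP k; have [U mE] := cardinalP m; rewrite kE mE.
have [|UT] := card_le_total [set: T] [set: U]; first by move=> /cardinal_leP.
apply/cardinal_leP; apply: contrapT => nTU; apply: nmk.
rewrite kE mE; split; first exact/cardinal_leP.
by move=> /cardinal_ofP; rewrite card_eq_le => /andP[_ /nTU].
Qed.

Lemma cardinal_ltNge k m : k < m <-> ~ m <= k.
Proof. by rewrite cardinal_leNgt notK. Qed.

Lemma cardinal_leVlt k m : k <= m \/ m < k.
Proof.
by have [|nmk] := pselect (m < k); [right|left; apply/cardinal_leNgt].
Qed.

Lemma cardinal_le_lt_trans m k n : k <= m -> m < n -> k < n.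
Proof.
by rewrite !cardinal_ltNge => km nm nk; apply: nm;
  exact: cardinal_le_trans nk km.
Qed.

Lemma cardinal_lt_le_trans m k n : k < m -> m <= n -> k < n.
Proof.
by rewrite !cardinal_ltNge => km nm nk; apply: km;
  exact: cardinal_le_trans nm nk.
Qed.

Lemma cardinal_ltW k m : k < m -> k <= m.
Proof. by case. Qed.

Lemma cardinal_lt_irr k : ~ k < k.
Proof. by case. Qed.

Lemma cardinal_le_set (T : Type) (B : set T) k : k <= cardinal_of B ->
  exists2 A, A `<=` B & k = cardinal_of A.
Proof.
have [U [D ->]] := cardinal_of_set k => /cardinal_of_leP /card_subP[A AD AB].
by exists A => //; apply/cardinal_of_eqP/card_esym.
Qed.

Lemma cardinal_ge0 k : cardinal_of void <= k.
Proof.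
have [T ->] := cardinalP k; apply/cardinal_leP.
by apply: (@card_le_rel _ _ _ _ (fun _ _ => True)) => -[].
Qed.

Lemma cardinal_gt0P (T : Type) (A : set T) :
  cardinal_of void < cardinal_of A <-> A !=set0.
Proof.
have v0 : [set: void] = set0 by rewrite -subset0 => -[].
split=> [[_ A0]|[a Aa]].
  apply: contrapT => nA; apply: A0; apply/cardinal_ofP.
  rewrite v0 card_eq_sym card_eq0; apply/eqP; rewrite -subset0 => x _.
  by case: nA; exists (set_val x); exact: set_valP.
split=> [|/cardinal_ofP]; first exact: cardinal_ge0.
rewrite v0 card_eq_sym card_eq0 => /eqP/seteqP[+ _].
by move=> /(_ (SigSub (mem_set Aa)))/(_ I).
Qed.

(* Among the subsets A of T whose cardinal lies in S, one of least cardinality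
   is found by taking a maximal set of choice functions of these subsets on
   which every evaluation is injective: some evaluation is then onto. *)
Lemma cardinal_minP (S : cardinal -> Prop) : (exists k, S k) ->
  exists k, S k /\ forall m, S m -> k <= m.
Proof.
move=> [k Sk]; have [T [D kE]] := cardinal_of_set k.
pose I A := A `<=` D /\ S (cardinal_of A).
have ID : I D by split=> //; rewrite -kE.
suff [A [IA Amin]] : exists A, I A /\ forall B, I B -> A #<= B.
  exists (cardinal_of A); split=> [|m Sm]; first by case: IA.
  have [mD|/cardinal_ltW Dm] := cardinal_leVlt m (cardinal_of D).
    have [B BD mE] := cardinal_le_set mD.
    by rewrite mE; apply/cardinal_of_leP/Amin; split; rewrite // -mE.
  by apply: cardinal_le_trans Dm; apply/cardinal_of_leP/Amin.
pose P (G : set (set T -> T)) := (forall f A, G f -> I A -> A (f A)) /\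
  (forall f g A, G f -> G g -> I A -> f A = g A -> f = g).
have [||G [[GI Gi] _ maxG]] := @Zorn_above _ P set0; first by split.
  move=> F FP totF _; split=> [f A [X /FP[XI _]]|f g A [X FX Xf] [Y FY Yg]].
    exact: (XI f A).
  have [XY|YX] := totF _ _ FX FY.
    by have [_ Yi] := FP _ FY; apply: Yi => //; exact: XY.
  by have [_ Xi] := FP _ FX; apply: Xi => //; exact: YX.
have [[A [IA Aonto]]|nonto] :=
    pselect (exists A, I A /\ forall a, A a -> exists2 f, G f & f A = a).
  exists A; split=> // B IB.
  apply: (@card_le_rel _ _ _ _ (fun a b => exists f, [/\ G f, f A = a & f B = b])).
    by move=> a /Aonto[f Gf fA]; exists (f B); [exact: (GI f B)|exists f].
  move=> a a' b _ _ _ [f [Gf <- fB]] [g [Gg <- gB]].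
  by rewrite (Gi f g B) // fB gB.
(* If no evaluation is onto, each [A] in [I] has a point missed by all of [G]; a function [h]
   choosing such points can be added to [G]. Outside [I] any value will do, and an empty [T] would
   contradict [nonto] at [D]. *)
have /choice[h hP] : forall A, exists a, I A -> A a /\ forall f, G f ->
  f A <> a.
  move=> A; have [IA|] := pselect (I A); last first.
    have [[t _]|T0] := pselect (exists t : T, True); first by exists t.
    case: nonto; exists D; split=> // a; by case: T0; exists a.
  apply: contrapT => nh; apply: nonto; exists A; split=> // a Aa.
  by apply: contrapT => nf; apply: nh; exists a => _; split=> // f Gf fA;
    apply: nf;
    exists f.
suff PG' : P (G `|` [set h]).
  have Gh : G h by apply: (maxG _ _ PG'); [move=> f; left|right].
  by have [_ /(_ _ Gh)] := hP _ ID.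
split=> [f A [Gf|->] IA|f g A [Gf|->] [Gg|->] IA // fg].
- exact: (GI f A).
- by have [] := hP _ IA.
- exact: Gi fg.
- by have [_ /(_ _ Gf)] := hP _ IA.
- by have [_ /(_ _ Gg)] := hP _ IA; rewrite fg.
Qed.

Lemma cardinal_min_spec (S : cardinal -> Prop) : (exists k, S k) ->
  S (cardinal_min S) /\ forall m, S m -> cardinal_min S <= m.
Proof.
move=> /cardinal_minP exk; rewrite /cardinal_min /cardinal_choose.
by case: pselect => // ex; exact: (proj2_sig (cid ex)).
Qed.

Lemma cardinal_minE (S : cardinal -> Prop) k :
  S k -> (forall m, S m -> k <= m) -> cardinal_min S = k.
Proof.
move=> Sk kmin; have [Sm mmin] := cardinal_min_spec (ex_intro _ k Sk).
by apply: cardinal_le_anti; [exact: mmin|exact: kmin].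
Qed.

(** Cantor's diagonal argument, run on a relation [R] that injects the subsets of [T] into [T]. *)
Lemma cardinal_exists_gt k : exists m, k < m.
Proof.
have [T ->] := cardinalP k; exists (cardinal_of (set T)); apply/cardinal_ltNge.
move=> /cardinal_leP /card_le_relP[R [_ Rt _ Ri]].
pose D : set T := fun t => exists2 A, R A t & ~ A t.
have [t RDt] := Rt D Logic.I; have [Dt|nDt] := pselect (D t).
  by have [A RAt] := Dt; rewrite (Ri _ _ _ RAt RDt).
by apply: (nDt); exists D.
Qed.

Lemma cardinal_lt_succ k : k < cardinal_succ k.
Proof. by have [] := cardinal_min_spec (cardinal_exists_gt k). Qed.

Lemma cardinal_succ_le k m : cardinal_succ k <= m <-> k < m.
Proof.
split=> [|km]; first exact/cardinal_lt_le_trans/cardinal_lt_succ.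
by have [_] := cardinal_min_spec (cardinal_exists_gt k); exact.
Qed.

Lemma cardinal_lt_succP k m : k < cardinal_succ m <-> k <= m.
Proof. by rewrite cardinal_ltNge cardinal_succ_le -cardinal_leNgt. Qed.

Lemma cardinal_le_succ k m : k <= m -> cardinal_succ k <= cardinal_succ m.
Proof. by move=> km; apply/cardinal_succ_le/cardinal_lt_succP. Qed.

(** * Bases and dimension *)

Section LinearAlgebra.
Local Open Scope ring_scope.
Local Open Scope cardinal_scope.
Variables (K : fieldType) (V : lmodType K).
Implicit Types (B S W X Y Z F : set V).

Lemma lin_subspaceP W : lin_subspace W <->
  W 0 /\ forall a u v, W u -> W v -> W (a *: u + v).
Proof.
split=> [[W0 Wl]|[W0 Wl]]; split.
- exact: set_mem.
- by move=> a u v /mem_set Wu /mem_set Wv; apply: set_mem; exact: Wl.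
- exact: mem_set.
- by move=> a u v /set_mem Wu /set_mem Wv; apply: mem_set; exact: Wl.
Qed.

Section Subspace.
Variable W : set V.
Hypothesis subW : lin_subspace W.

Lemma lin_subspace0 : W 0.
Proof. by have /lin_subspaceP[] := subW. Qed.

Lemma lin_subspaceZD a u v : W u -> W v -> W (a *: u + v).
Proof. by have /lin_subspaceP[_] := subW; apply. Qed.

Lemma lin_subspaceZ a u : W u -> W (a *: u).
Proof. by move=> Wu; rewrite -[_ *: _]addr0;
  apply: lin_subspaceZD lin_subspace0. Qed.

Lemma lin_subspaceD u v : W u -> W v -> W (u + v).
Proof. by move=> Wu; rewrite -[u]scale1r; exact: lin_subspaceZD. Qed.

Lemma lin_subspaceB u v : W u -> W v -> W (u - v).
Proof. by move=> Wu Wv; rewrite addrC -scaleN1r; exact: lin_subspaceZD. Qed.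

Lemma lin_subspace_sum (s : seq V) (c : V -> K) :
  [set` s] `<=` W -> W (\sum_(v <- s) c v *: v).
Proof.
move=> sW; rewrite big_seq; apply: (@big_ind V W).
- exact: lin_subspace0.
- exact: lin_subspaceD.
- by move=> v vs; apply: lin_subspaceZ; exact: sW.
Qed.

Lemma lin_span_min S : S `<=` W -> lin_span S `<=` W.
Proof.
by move=> SW _ [s [c [sS ->]]]; apply: lin_subspace_sum => v /sS/SW.
Qed.

End Subspace.

Lemma lin_subspaceT : lin_subspace [set: V].
Proof. exact/lin_subspaceP. Qed.

Lemma lin_subspace_set0 : lin_subspace [set 0 : V].
Proof.
by apply/lin_subspaceP; split=> // a u v -> ->; rewrite /= scaler0 addr0.
Qed.

(** Padding with zero coefficients brings combinations over different lists to a common list, where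
    they can be added and compared. *)
Lemma sum_subseq (s t : seq V) (c : V -> K) : uniq s -> uniq t ->
  [set` s] `<=` [set` t] ->
  \sum_(v <- s) c v *: v = \sum_(v <- t) (if v \in s then c v else 0) *: v.
Proof.
move=> us ut st; rewrite [RHS](bigID (mem s)) /= [X in _ + X]big1 ?addr0;
  last first.
  by move=> v /negbTE ->; rewrite scale0r.
rewrite -[RHS]big_filter; have st_perm : perm_eq s [seq v <- t | v \in s].
  apply: uniq_perm => // [|v]; first exact: filter_uniq.
  rewrite mem_filter; apply/idP/andP => [vs|[]//].
  by split=> //; exact: st.
by rewrite -(perm_big _ st_perm) /= !big_seq; apply: eq_bigr => v ->.
Qed.

Lemma lin_subspace_uniq_span S :
  lin_subspace [set u | exists (s : seq V) (c : V -> K),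
    [/\ uniq s, [set` s] `<=` S & u = \sum_(v <- s) c v *: v]].
Proof.
apply/lin_subspaceP; split; first by exists [::], (fun=> 0); rewrite big_nil.
move=> a _ _ [s [c [us sS ->]]] [t [d [ut tS ->]]].
pose r := undup (s ++ t); have ur : uniq r := undup_uniq _.
exists r, (fun v => a * (if v \in s then c v else 0) + (if v \in t then d v else 0)).
split=> // [v /=|]; first by rewrite mem_undup mem_cat => /orP[/sS|/tS].
rewrite (sum_subseq _ us ur) ?(sum_subseq _ ut ur).
- by rewrite scaler_sumr -big_split; apply: eq_bigr => v _;
    rewrite scalerDl scalerA.
- by move=> v /= vt; rewrite mem_undup mem_cat vt orbT.
- by move=> v /= vs; rewrite mem_undup mem_cat vs.
Qed.

Lemma lin_span_uniq S u : lin_span S u <->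
  exists (s : seq V) (c : V -> K),
    [/\ uniq s, [set` s] `<=` S & u = \sum_(v <- s) c v *: v].
Proof.
split=> [|[s [c [_ sS ->]]]]; last by exists s, c.
apply: (lin_span_min (lin_subspace_uniq_span S)) u.
move=> v Sv; exists [:: v], (fun=> 1).
split=> //; last by rewrite big_seq1 scale1r.
by move=> w; rewrite /= inE => /eqP ->.
Qed.

Lemma lin_subspace_span S : lin_subspace (lin_span S).
Proof.
have /lin_subspaceP[U0 UZD] := lin_subspace_uniq_span S.
apply/lin_subspaceP; split=> [|a u v]; first exact/lin_span_uniq.
by move=> /lin_span_uniq Uu /lin_span_uniq Uv; apply/lin_span_uniq/UZD.
Qed.

Lemma sub_lin_span S : S `<=` lin_span S.
Proof.
move=> v Sv; exists [:: v], (fun=> 1).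
split; last by rewrite big_seq1 scale1r.
by move=> w; rewrite /= inE => /eqP ->.
Qed.

Lemma lin_span_mono S S' : S `<=` S' -> lin_span S `<=` lin_span S'.
Proof.
by move=> SS'; apply: (lin_span_min (lin_subspace_span _)) => v /SS'/sub_lin_span.
Qed.

Lemma lin_span0 : lin_span (set0 : set V) = [set 0].
Proof.
apply/seteqP; split=> [|_ ->]; first exact: (lin_span_min lin_subspace_set0).
exact: lin_subspace0 (lin_subspace_span _).
Qed.

(** [s] lists the vectors with nonzero coefficient in the expansion of [x]. Two expansions differ by
    a vanishing combination over the merged list, so independence makes their coefficients agree.
    Membership in spans of subsets of [B] thereby becomes inclusion of sets. *)
Lemma lin_support B x : lin_indep B -> lin_span B x ->
  exists s : seq V, [set` s] `<=` B /\
    forall S, S `<=` B -> (lin_span S x <-> [set` s] `<=` S).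
Proof.
move=> indB /lin_span_uniq[s0 [c [us0 s0B xE]]].
pose s := [seq v <- s0 | c v != 0].
have us : uniq s := filter_uniq _ us0.
have sB : [set` s] `<=` B by move=> v /=; rewrite mem_filter => /andP[_ /s0B].
have {}xE : x = \sum_(v <- s) c v *: v.
  rewrite xE (bigID (fun v => c v == 0)) big1 /= ?add0r ?big_filter//.
  by move=> v /eqP ->; rewrite scale0r.
exists s; split=> // S SB; split=> [/lin_span_uniq[t [d [ut tS xE']]]|sS];
  last first.
  by rewrite xE; exists s, c.
move=> v vs; apply: contrapT => nSv.
pose r := undup (s ++ t); have ur : uniq r := undup_uniq _.
have sr : [set` s] `<=` [set` r] by move=> w /= ws;
  rewrite mem_undup mem_cat ws.
have tr : [set` t] `<=` [set` r].
  by move=> w /= wt; rewrite mem_undup mem_cat wt orbT.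
have rB : [set` r] `<=` B.
  by move=> w /=; rewrite mem_undup mem_cat => /orP[/sB//|/tS/SB].
have := indB r (fun v => (if v \in s then c v else 0) - (if v \in t then d v else 0))
  ur rB.
rewrite (_ : \sum_(_ <- _) _ = 0); last first.
  under eq_bigr do rewrite scalerBl.
  by rewrite sumrB -!sum_subseq// -xE -xE' subrr.
move=> /(_ erefl v (sr _ vs)); rewrite vs; case: ifP => [/tS//|_].
rewrite subr0 => cv0; move: vs; rewrite /= mem_filter cv0 eqxx //.
Qed.

Lemma lin_indep_sub B S : S `<=` B -> lin_indep B -> lin_indep S.
Proof. by move=> SB indB s c us sS; apply: indB => // v /sS/SB. Qed.

(** Otherwise the support of [x] would lie both in the singleton of [x] and in its complement, hence
    be empty, and [x] would be 0. *)
Lemma lin_indep_notin_span B x : lin_indep B -> B x -> ~ lin_span (B `\ x) x.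
Proof.
move=> indB Bx; have [s [sB sP]] := lin_support indB (sub_lin_span Bx).
have sx1 : [set` s] `<=` [set x] by apply/sP; [move=> _ ->
  | exact: sub_lin_span].
move=> /(sP _ (@subDsetl _ B [set x])) s'.
have : lin_span set0 x by apply/sP => // v vs;
  have [_ /(_ (sx1 _ vs))] := s' v vs.
rewrite lin_span0 => x0.
have xB : [set` [:: x]] `<=` B by move=> v; rewrite /= inE => /eqP ->.
have := indB [:: x] (fun=> 1) isT xB; rewrite big_seq1 scale1r.
by move=> /(_ x0 x (mem_head _ _))/eqP; rewrite oner_eq0.
Qed.

Lemma lin_indepU1 B x : lin_indep B -> ~ lin_span B x -> lin_indep (x |` B).
Proof.
move=> indB nBx s c us sB s0.
have remB : [set` rem x s] `<=` B.
  by move=> v; rewrite /= mem_rem_uniq // !inE => /andP[/eqP vx /sB[]].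
have [xs|nxs] := boolP (x \in s); last first.
  by apply: indB => // v vs; have [vx|//] := sB _ vs; rewrite -vx vs in nxs.
have sE : c x *: x + \sum_(v <- rem x s) c v *: v = 0.
  by move: s0; rewrite (big_rem x xs).
have cx : c x = 0.
  apply: contrapT => /eqP cx0; apply: nBx.
  have -> : x = (- (c x)^-1) *: \sum_(v <- rem x s) c v *: v.
    move: sE => /eqP; rewrite addrC addr_eq0 => /eqP ->.
    by rewrite scalerN scaleNr opprK scalerA mulVf// scale1r.
  by apply: lin_subspaceZ (lin_subspace_span _) _ _ _; exists (rem x s), c.
move=> v vs; have [->//|vx] := eqVneq v x.
apply: (indB (rem x s)) => //; first exact: rem_uniq.
  by move: sE; rewrite cx scale0r add0r.
by rewrite mem_rem_uniq // !inE vx.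
Qed.

Lemma lin_indep_bigcup (F : set (set V)) : F `<=` @lin_indep K V ->
  total_on F subset -> lin_indep (\bigcup_(X in F) X).
Proof.
move=> indF totF s c us sF s0 v vs.
have [X FX sX] : exists2 X, F X & [set` s] `<=` X.
  by apply: chain_seq => //; have [X FX _] := sF _ vs; exists X.
exact: indF FX s c us sX s0 v vs.
Qed.

Lemma lin_basis_extend B W : lin_indep B -> B `<=` W -> lin_subspace W ->
  exists2 C, B `<=` C & lin_basis W C.
Proof.
move=> indB BW subW.
have [||C [[indC CW] BC maxC]] :=
    @Zorn_above _ [set X | lin_indep X /\ X `<=` W] B.
- by [].
- move=> F FP totF _; split; last by move=> x [X /FP[_ XW] /XW].
  by apply: lin_indep_bigcup => // X /FP[].
exists C => //; split=> //; apply/seteqP; split; first exact: lin_span_min.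
move=> x Wx; have [//|nCx] := pselect (lin_span C x); apply: sub_lin_span.
apply: (maxC (x |` C)); [by move=> y; right| |by left].
split; last by move=> v [->|/CW].
exact: lin_indepU1.
Qed.

Lemma lin_indep0 : lin_indep (set0 : set V).
Proof. by move=> s c _ s0 _ v /s0. Qed.

Lemma lin_basis_exists W : lin_subspace W -> exists B, lin_basis W B.
Proof.
by move=> /(lin_basis_extend lin_indep0 (@sub0set _ W))[B _ bB]; exists B.
Qed.

(* Steinitz exchange, by Zorn's lemma: G is a maximal partial injection of the
   independent set A into B such that replacing its domain by its range
   in A preserves independence. *)
Lemma lin_indep_card_le A B : lin_indep A -> A `<=` lin_span B -> A #<= B.
Proof.
move=> indA AB; pose dom (G : set (V * V)) := [set a | exists b, G (a, b)].
pose ran (G : set (V * V)) := [set b | exists a, G (a, b)].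
pose M G := (A `\` dom G) `|` ran G.
(* The third condition keeps [ran G] disjoint from the part of [A] not yet exchanged, so that
   exchanging [x] really removes it from [M G]. *)
pose P (G : set (V * V)) := [/\ forall a b, G (a, b) -> A a /\ B b,
  forall a a' b, G (a, b) -> G (a', b) -> a = a',
  (forall a, A a -> ran G a -> dom G a) & lin_indep (M G)].
have [||G [[GAB Gi Gd indM] _ maxG]] := @Zorn_above _ P set0.
- split=> //; apply: lin_indep_sub indA => x [[]//|[a []]].
- move=> F FP totF [G0 FG0]; split.
  + by move=> a b [X /FP[XAB _ _ _] /XAB].
  + move=> a a' b [X FX Xb] [Y FY Yb]; have [XY|YX] := totF _ _ FX FY.
      by have [_ Yi _ _] := FP _ FY; apply: Yi Yb; exact: XY.
    by have [_ Xi _ _] := FP _ FX; apply: Xi Xb _; exact: YX.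
  + move=> a Aa [b [X FX Xba]]; have [_ _ Xd _] := FP _ FX.
    by have [|c Xac] := Xd a Aa; [exists b|exists c; exists X].
  + move=> s c us sM s0.
    (* [M] is not monotone, since its first part shrinks as [G] grows. Yet a vector of [M] of the
       union is either never exchanged along the chain, or belongs to the range from some member on;
       so finitely many vectors lie in [M Y] for all large [Y]. *)
    suff [X FX sX] : exists2 X : set (V * V), F X &
        forall Y : set (V * V), F Y -> X `<=` Y -> [set` s] `<=` M Y.
      by have [_ _ _ indX] := FP _ FX; exact: (indX s c us (sX _ FX _) s0).
    elim: s {us s0} sM => [_|x s IH sM]; first by exists G0.
    have [|X FX sX] := IH; first by move=> y ys; apply: sM;
      rewrite /= inE ys orbT.
    have [[Ax nx]|[a [Z FZ Zax]]] := sM x (mem_head _ _).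
      exists X => // Y FY XY y /=; rewrite inE => /predU1P[->|]; last exact: sX.
      by left; split=> // -[b Yb]; apply: nx; exists b, Y.
    have [XZ|ZX] := totF _ _ FX FZ.
      exists Z => // Y FY ZY y /=; rewrite inE => /predU1P[->|].
        by right; exists a; exact: ZY.
      by apply: sX => // p /XZ/ZY.
    exists X => // Y FY XY y /=; rewrite inE => /predU1P[->|].
      by right; exists a; apply/XY/ZX.
    exact: sX.
have [Adom|/existsNP[x /not_implyP[Ax nx]]] := pselect (forall a, A a ->
  dom G a).
  apply: (@card_le_rel _ _ _ _ (fun a b => G (a, b))) => [a /Adom[b Gab]|].
    by exists b => //; have [] := GAB _ _ Gab.
  by move=> a a' b _ _ _; exact: Gi.
have Mx : M G x by left.
have nspan := lin_indep_notin_span indM Mx.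
(* [x] is in the span of [B] but not in that of the rest of [M G], so some [b] in [B] is outside the
   latter and can replace [x]. *)
have [b Bb nb] : exists2 b, B b & ~ lin_span (M G `\ x) b.
  apply: contrapT => nB; apply: nspan.
  apply: (lin_span_min (lin_subspace_span _)) (AB _ Ax) => b Bb.
  by apply: contrapT => nb; apply: nB; exists b.
have nranb : ~ ran G b.
  move=> Gb; apply: nb; apply: sub_lin_span; split; first by right.
  by move=> bx; apply: nx; apply: Gd => //; rewrite -bx.
suff PG' : P (G `|` [set (x, b)]).
  by case: nx; exists b; apply: (maxG _ _ PG'); [move=> p; left|right].
split.
- by move=> a b' [/GAB//|[-> ->]].
- move=> a a' b' [Gb|[aE bE]] [Gb'|[aE' bE']]; first exact: Gi Gb Gb'.
  + by case: nranb; exists a; rewrite -bE'.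
  + by case: nranb; exists a'; rewrite -bE.
  + by rewrite aE aE'.
- move=> a Aa [a' [Ga|[_ ab]]].
    by have [|c Gc] := Gd a Aa; [exists a'|exists c; left].
  have [->|/eqP ax] := eqVneq a x; first by exists b; right.
  apply: contrapT => nda; apply: nb; apply: sub_lin_span; rewrite -ab;
    split=> //.
  by left; split=> // -[c Gc]; apply: nda; exists c; left.
- apply: (@lin_indep_sub (b |` (M G `\ x))).
    move=> z [[Az nz]|[a [Ga|[_ ->]]]]; last by left.
      right; split; first by left; split=> // -[c Gc]; apply: nz; exists c;
        left.
      by move=> zx; apply: nz; exists b; right; rewrite zx.
    right; split; first by right; exists a.
    by move=> zx; apply: nx; apply: Gd => //; exists a; rewrite -zx.
  by apply: lin_indepU1 => //; apply: lin_indep_sub indM; exact: subDsetl.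
Qed.

Lemma lin_dimE W B : lin_basis W B -> lin_dim W = cardinal_of B.
Proof.
move=> bB; rewrite /lin_dim /cardinal_choose; case: pselect => [ex|];
  last first.
  by case; exists (cardinal_of B), B.
have [C [indC CW] ->] := proj2_sig (cid ex); apply/cardinal_of_eqP.
have [indB BW] := bB.
rewrite card_eq_le; apply/andP; split; apply: lin_indep_card_le => //.
  by rewrite BW -CW; exact: sub_lin_span.
by rewrite CW -BW; exact: sub_lin_span.
Qed.

Lemma lin_dim_span B : lin_indep B -> lin_dim (lin_span B) = cardinal_of B.
Proof. by move=> indB; exact: lin_dimE. Qed.

Lemma lin_dim_le W X : lin_subspace W -> lin_subspace X -> W `<=` X ->
  lin_dim W <= lin_dim X.
Proof.
move=> subW subX WX; have [B [indB BW]] := lin_basis_exists subW.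
have [|C BC bC] := lin_basis_extend indB _ subX.
  by apply: subset_trans WX; rewrite -BW; exact: sub_lin_span.
rewrite (lin_dimE (conj indB BW)) (lin_dimE bC); apply/cardinal_of_leP.
exact: subset_card_le.
Qed.

Lemma lin_intermediate Y Z k : lin_subspace Y -> lin_subspace Z -> Y `<=` Z ->
  lin_dim Y <= k -> k <= lin_dim Z ->
  exists X, [/\ lin_subspace X, Y `<=` X, X `<=` Z & lin_dim X = k].
Proof.
move=> subY subZ YZ; have [B [indB BY]] := lin_basis_exists subY.
have [|C BC [indC CZ]] := lin_basis_extend indB _ subZ.
  by apply: subset_trans YZ; rewrite -BY; exact: sub_lin_span.
rewrite (lin_dimE (conj indB BY)) (lin_dimE (conj indC CZ)).
have [T [D ->]] := cardinal_of_set k => /cardinal_of_leP BD /cardinal_of_leP DC.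
have [E [BE EC ED]] := card_intermediate BC BD DC.
exists (lin_span E); split; first exact: lin_subspace_span.
- by rewrite -BY; exact: lin_span_mono.
- by rewrite -CZ; exact: lin_span_mono.
- rewrite lin_dim_span; first exact/cardinal_of_eqP.
  exact: lin_indep_sub indC.
Qed.

Lemma lin_dim_set0 : lin_dim [set 0 : V] = cardinal_of void.
Proof.
rewrite -lin_span0 lin_dim_span; last exact: lin_indep0.
apply: cardinal_le_anti; last exact: cardinal_ge0.
by apply/cardinal_leNgt => /cardinal_gt0P[].
Qed.

Lemma lin_dim_le_card W : lin_subspace W -> lin_dim W <= cardinal_of V.
Proof.
move=> subW; have [B bB] := lin_basis_exists subW; rewrite (lin_dimE bB).
by apply/cardinal_leP; rewrite (card_le_eql (card_setT B)); exact: card_leT.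
Qed.

End LinearAlgebra.

(** * Lineability numbers and maximal subspaces *)

Section Lineability.
Variables (K : fieldType) (V : lmodType K).
Implicit Types (W X Y Z F : set V).

Definition maximal_subspace F Z := [/\ lin_subspace Z, Z `<=` F `|` [set 0%R] &
  forall X, lin_subspace X -> Z `<=` X -> X `<=` F `|` [set 0%R] -> X `<=` Z].

Lemma lin_subspace_bigcup (C : set (set V)) : C `<=` @lin_subspace K V ->
  total_on C subset -> C !=set0 -> lin_subspace (\bigcup_(X in C) X).
Proof.
move=> subC totC [X0 CX0]; apply/lin_subspaceP; split.
  by exists X0 => //; exact: lin_subspace0 (subC _ CX0).
move=> a u v [X CX Xu] [Y CY Yv]; have [XY|YX] := totC _ _ CX CY.
  by exists Y => //; apply: (lin_subspaceZD (subC _ CY)) => //; exact: XY.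
by exists X => //; apply: (lin_subspaceZD (subC _ CX)) => //; exact: YX.
Qed.

Lemma maximal_subspace_exists F Y : lin_subspace Y -> Y `<=` F `|` [set 0%R] ->
  exists2 Z, maximal_subspace F Z & Y `<=` Z.
Proof.
move=> subY YF.
have [||Z [[subZ ZF] YZ maxZ]] :=
    @Zorn_above _ [set X | lin_subspace X /\ X `<=` F `|` [set 0%R]] Y.
- by [].
- move=> C CP totC C0; split; last by move=> x [X /CP[_ XF] /XF].
  by apply: lin_subspace_bigcup => // X /CP[].
by exists Z => //; split=> // X subX ZX XF; exact: maxZ.
Qed.

Lemma sub_set0 F : [set 0%R : V] `<=` F `|` [set 0%R].
Proof. by move=> x ->; right. Qed.

Lemma maximal_subspace_nonextendable F Z : maximal_subspace F Z ->
  nonextendable_at F (cardinal_succ (lin_dim Z)).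
Proof.
move=> [subZ ZF maxZ]; exists Z; split=> //; first exact: cardinal_lt_succ.
move=> [X [subX ZX XF dimX]]; apply: (@cardinal_lt_irr (lin_dim Z)).
rewrite [X in _ < X](_ : _ = lin_dim X); last first.
  by congr lin_dim; apply/seteqP; split=> //; exact: maxZ.
by rewrite dimX; exact: cardinal_lt_succ.
Qed.

(* Above the subspace witnessing nonextendability take a maximal one: its
   dimension is still below k, for otherwise an intermediate subspace of
   dimension k would exist. *)
Lemma nonextendable_maximal F k : nonextendable_at F k ->
  exists2 Z, maximal_subspace F Z & lin_dim Z < k.
Proof.
move=> [Y [subY YF Yk noX]]; have [Z maxZ YZ] :=
  maximal_subspace_exists subY YF.
have [subZ ZF _] := maxZ; exists Z => //; apply/cardinal_ltNge => kZ;
  apply: noX.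
have [X [subX YX XZ dimX]] := lin_intermediate subY subZ YZ (cardinal_ltW Yk) kZ.
by exists X; split=> //; exact: subset_trans ZF.
Qed.

Lemma homogeneous_lineability_spec F :
  (homogeneous_lineability_number F = cardinal_succ (cardinal_of V) \/
    nonextendable_at F (homogeneous_lineability_number F)) /\
  forall m, m = cardinal_succ (cardinal_of V) \/ nonextendable_at F m ->
    homogeneous_lineability_number F <= m.
Proof.
by apply: cardinal_min_spec; exists (cardinal_succ (cardinal_of V)); left.
Qed.

Lemma homogeneous_lineability_le F Z : maximal_subspace F Z ->
  homogeneous_lineability_number F <= cardinal_succ (lin_dim Z).
Proof.
move=> maxZ; have [_] := homogeneous_lineability_spec F; apply; right.
exact: maximal_subspace_nonextendable.
Qed.

Lemma homogeneous_lineabilityE F : exists2 Z, maximal_subspace F Z &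
  homogeneous_lineability_number F = cardinal_succ (lin_dim Z).
Proof.
suff [Z maxZ ZHL] : exists2 Z, maximal_subspace F Z &
    lin_dim Z < homogeneous_lineability_number F.
  exists Z => //; apply: cardinal_le_anti; last exact/cardinal_succ_le.
  exact: homogeneous_lineability_le.
have [[->|/nonextendable_maximal//] _] := homogeneous_lineability_spec F.
(* If the minimum is the default value, any maximal subspace will do, its dimension being at most
   the cardinality of V. *)
have [Z maxZ _] := maximal_subspace_exists (@lin_subspace_set0 K V) (@sub_set0 F).
exists Z => //; apply/cardinal_lt_succP; apply: lin_dim_le_card.
by case: maxZ.
Qed.

Lemma not_lineable_gt F : ~ lineable F (cardinal_succ (lin_dim [set: V])).
Proof.
move=> [W [subW _ dimW]]; apply: (@cardinal_lt_irr (lin_dim W)).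
rewrite {2}dimW; apply/cardinal_lt_succP; apply: lin_dim_le => //.
exact: lin_subspaceT.
Qed.

Lemma homogeneous_lineability_le_lineability F :
  homogeneous_lineability_number F <= lineability_number F.
Proof.
have [_] := homogeneous_lineability_spec F; apply; right.
have [nL _] := cardinal_min_spec (ex_intro (fun k => ~ lineable F k) _ (@not_lineable_gt F)).
exists [set 0%R]; split; [exact: lin_subspace_set0|exact: sub_set0| |].
  rewrite lin_dim_set0; split; first exact: cardinal_ge0.
  move=> L0; apply: nL; exists [set 0%R]; split.
  - exact: lin_subspace_set0.
  - exact: sub_set0.
  - by rewrite lin_dim_set0.
by move=> [X [subX _ XF dimX]]; apply: nL; exists X.
Qed.

(** The common frame of all constructions, with [W0] a maximal subspace of least dimension. A
    maximal subspace of the union lies in a member, hence equals it; that member is either inside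
    [W0], so equal to it, or at least as large, which gives HL. For L, the members are too small for
    dimension [k], while their subspaces realize every dimension below it. *)
Lemma lineability_bigcup (C : set (set V)) W0 k :
  C `<=` @lin_subspace K V -> C W0 ->
  (forall X, lin_subspace X -> X `<=` \bigcup_(W in C) W ->
    exists2 W, C W & X `<=` W) ->
  (forall W, C W -> W0 `<=` W -> W `<=` W0) ->
  (forall W, C W -> W `<=` W0 \/ lin_dim W0 <= lin_dim W) ->
  (forall W, C W -> lin_dim W < k) ->
  (forall m, m < k -> exists2 W, C W & m <= lin_dim W) ->
  homogeneous_lineability_number (\bigcup_(W in C) W) = cardinal_succ (lin_dim W0)
  /\ lineability_number (\bigcup_(W in C) W) = k.
Proof.
move=> subC CW0 inC maxW0 minW0 ltk cofk; set F := \bigcup_(W in C) W.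
have F0 : F `|` [set 0%R] = F.
  apply/setUidPl => x ->; exists W0 => //.
  exact: lin_subspace0 (subC _ CW0).
have CF W : C W -> W `<=` F by move=> CW x Wx; exists W.
split.
  apply: cardinal_le_anti.
    apply: homogeneous_lineability_le; split; first exact: subC.
      by rewrite F0; exact: CF.
    rewrite F0 => X subX W0X /(inC _ subX)[W CW XW]; apply: (subset_trans XW).
    by apply: maxW0 => //; exact: subset_trans W0X XW.
  have [Z [subZ + maxZ] ->] := homogeneous_lineabilityE F; rewrite F0 in maxZ *.
  move=> /(inC _ subZ)[W CW ZW]; apply: cardinal_le_succ.
  have WZ : W `<=` Z by apply: maxZ => //; [exact: subC|exact: CF].
  have [WW0|dimW] := minW0 _ CW; last first.
    by apply: cardinal_le_trans dimW _; apply: lin_dim_le => //; exact: subC.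
  apply: lin_dim_le => //; first exact: subC.
  apply: maxZ; [exact: subC| |exact: CF].
  exact: subset_trans ZW WW0.
apply: cardinal_minE.
  move=> [X []]; rewrite F0 => subX /(inC _ subX)[W CW XW] dimX.
  apply: (@cardinal_lt_irr k); rewrite -{1}dimX.
  apply: cardinal_le_lt_trans (ltk _ CW); apply: lin_dim_le => //.
  exact: subC.
move=> m nL; apply/cardinal_leNgt => /cofk[W CW mW]; apply: nL.
have subW : lin_subspace W by exact: subC.
have [||X [subX _ XW dimX]] :=
  lin_intermediate (@lin_subspace_set0 K V) subW _ _ mW.
- by move=> x ->; exact: lin_subspace0.
- by rewrite lin_dim_set0; exact: cardinal_ge0.
- by exists X; split=> //; rewrite F0; apply: subset_trans XW _; exact: CF.
Qed.

End Lineability.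

(** * Infinite cardinals and well-orders *)

Lemma finite_card_le_infinite (T U : Type) (A : set T) (B : set U) :
  finite_set A -> infinite_set B -> A #<= B.
Proof.
move=> /finite_set_leP[n An] /infiniteP; apply: card_le_trans.
by apply: card_le_trans An _; exact: card_leT.
Qed.

(* By Zorn's lemma take a maximal set G of triples (b, x, y) forming, for b =
   true and b = false, two injective relations of the set E of all such x into
   itself with disjoint ranges. A copy of nat in D outside E would enlarge G,
   so E exhausts D up to a finite set. *)
Lemma card_setU_infinite (T U W : Type) (D : set T) (A B : set W) :
  infinite_set D -> A #<= D -> B #<= D -> A `|` B #<= D.
Proof.
move=> infD.
pose P (G : set (bool * T * T)) := [/\ forall b x y, G (b, x, y) -> D x,
  forall b x y b', G (b, x, y) -> exists z, G (b', x, z),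
  forall b x y, G (b, x, y) -> exists b' z, G (b', y, z) &
  forall b x b' x' y, G (b, x, y) -> G (b', x', y) -> b = b' /\ x = x'].
have [||G [[GD Gt Gr Gi] _ maxG]] := @Zorn_above _ P set0; first by split.
  move=> F FP totF _; split.
  - by move=> b x y [X /FP[XD _ _ _] /XD].
  - move=> b x y b' [X FX Xb]; have [_ Xt _ _] := FP _ FX.
    by have [z Xz] := Xt _ _ _ b' Xb; exists z, X.
  - move=> b x y [X FX Xb]; have [_ _ Xr _] := FP _ FX.
    by have [b' [z Xz]] := Xr _ _ _ Xb; exists b', z, X.
  - move=> b x b' x' y [X FX Xb] [Y FY Yb]; have [XY|YX] := totF _ _ FX FY.
      by have [_ _ _ Yi] := FP _ FY; apply: Yi Yb; exact: XY.
    by have [_ _ _ Xi] := FP _ FX; apply: Xi Xb _; exact: YX.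
pose E : set T := [set x | exists b y, G (b, x, y)].
have ED : E `<=` D by move=> x [b [y /GD]].
have finDE : finite_set (D `\` E).
  apply: contrapT => /infiniteP /card_le_relP[R [RD Rt Rf Ri]].
  have [x0 R0x0] := Rt 0%N Logic.I; have [_ [_]] := RD _ _ R0x0; apply.
  (* Along the copy x_0, x_1, ... of nat, the new triples send x_n to x_(2n) under [false] and to
     x_(2n+1) under [true]; parity recovers the boolean. *)
  suff PG' : P (G `|` [set p : bool * T * T |
      exists2 n, R n p.1.2 & R (n.*2 + p.1.1)%N p.2]).
    have [y Ry] := Rt (0.*2 + false)%N Logic.I.
    exists false, y; apply: (maxG _ _ PG'); first by move=> p; left.
    by right; exists 0%N.
  split=> [b x y [/GD//|[n /RD[_ []//]]]|b x y b'|b x y|b x b' x' y].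
  - move=> [Gb|[n Rx _]]; first by have [z Gz] := Gt _ _ _ b' Gb; exists z;
      left.
    by have [z Rz] := Rt (n.*2 + b')%N Logic.I; exists z; right; exists n.
  - move=> [Gb|[n _ Ry]].
      by have [b' [z Gz]] := Gr _ _ _ Gb; exists b', z; left.
    have [z Rz] := Rt ((n.*2 + b).*2 + false)%N Logic.I.
    by exists false, z; right; exists (n.*2 + b)%N.
  - move=> [Gb|[n /= Rx Ry]] [Gb'|[n' /= Rx' Ry']]; first exact: Gi Gb Gb'.
    + by have [_ [_]] := RD _ _ Ry'; case; exact: Gr Gb.
    + by have [_ [_]] := RD _ _ Ry; case; exact: Gr Gb'.
    + have e := Ri _ _ _ Ry Ry'.
      have bb' : b = b' by move: (congr1 odd e);
        rewrite !oddD !odd_double !oddb.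
      have nn' : n = n'.
        by move: e; rewrite bb' => /eqP; rewrite eqn_add2r => /eqP/double_inj.
      by split=> //; apply: Rf Rx _; rewrite nn'.
have infE : infinite_set E.
  move=> finE; apply: infD; rewrite (_ : D = E `|` (D `\` E)); last first.
    by rewrite setDUK.
  by rewrite finite_setU.
have UE (X : Type) (M N : set X) : M #<= E -> N #<= E -> M `|` N #<= E.
  move=> /card_le_relP[R [RE Rt Rf Ri]] /card_le_relP[S [SE St Sf Si]].
  (* [M] enters [E] through the relation marked [true], the rest of [N] through the one marked
     [false]; their ranges are disjoint. *)
  pose Q m e := (M m /\ exists2 x, R m x & G (true, x, e)) \/
    (~ M m /\ exists2 x, S m x & G (false, x, e)).
  apply: (@card_le_rel _ _ _ _ Q) => [m MNm|m m' e _ _ _].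
    have [Mm|nMm] := pselect (M m).
      have [x Rx] := Rt _ Mm; have [_ [b [y Gb]]] := RE _ _ Rx.
      have [z Gz] := Gt _ _ _ true Gb; exists z; last by left; split=> //;
        exists x.
      exact: Gr Gz.
    have [//|Nm] := MNm; have [x Sx] := St _ Nm.
    have [_ [b [y Gb]]] := SE _ _ Sx; have [z Gz] := Gt _ _ _ false Gb.
    by exists z; [exact: Gr Gz|right; split=> //; exists x].
  move=> [[_ [x Rx Gx]]|[_ [x Sx Gx]]] [[_ [y Ry Gy]]|[_ [y Sy Gy]]];
    have [//= _ xy] := Gi _ _ _ _ _ Gx Gy.
  - by apply: Ri Rx _; rewrite xy.
  - by apply: Si Sx _; rewrite xy.
have DE : D #<= E.
  rewrite -(setDUK ED); apply: UE => //.
  exact: finite_card_le_infinite.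
move=> AD BD; apply: card_le_trans (subset_card_le ED).
by apply: UE; [exact: card_le_trans AD DE|exact: card_le_trans BD DE].
Qed.

Lemma card_setU_lt (T U : Type) (D : set T) (A B : set U) : infinite_set D ->
  ~ (D #<= A) -> ~ (D #<= B) -> ~ (D #<= A `|` B).
Proof.
move=> infD; wlog AB : A B / A #<= B.
  move=> wl DA DB; have [AB|BA] := card_le_total A B; first exact: wl AB DA DB.
  by rewrite setUC; exact: wl BA DB DA.
move=> _ DB DAB; have [finB|infB] := pselect (finite_set B).
  apply: infD; apply: card_le_finite DAB _; rewrite finite_setU; split=> //.
  exact: card_le_finite finB.
by apply: DB; apply: card_le_trans DAB _; exact: card_setU_infinite.
Qed.

Lemma card_setD1_infinite (T : Type) (B : set T) x :
  infinite_set B -> B `\ x #= B.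
Proof.
move=> infB; have infBx : infinite_set (B `\ x).
  by apply: infinite_setD => //; exact: finite_set1.
rewrite card_eq_le card_le_setD /=.
apply: card_le_trans (subset_card_le (_ : _ `<=` [set x] `|` B `\ x)) _.
  by move=> y By; have [->|yx] := pselect (y = x); [left|right].
by apply: card_setU_infinite => //; exact: finite_card_le_infinite.
Qed.

Definition strict_well_order (T : Type) (lt : T -> T -> Prop) : Prop :=
  [/\ forall x, ~ lt x x, forall x y z, lt x y -> lt y z -> lt x z,
      forall x y, [\/ x = y, lt x y | lt y x] &
      forall P : set T, P !=set0 -> exists2 x, P x & forall y, P y -> ~ lt y x].

Lemma strict_well_order_exists (T : eqType) :
  exists lt : T -> T -> Prop, strict_well_order lt.
Proof.
have [R Rwo] := well_ordering_principle T.
have chR : wo_chain R predT by move=> A _; exact: Rwo.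
have Rtot x y : R x y || R y x by apply: (wo_chainW chR).
have Rxx x : R x x by have := Rtot x x; rewrite orbb.
have Ranti x y : R x y -> R y x -> x = y.
  by move=> xy yx; apply: (wo_chain_antisymmetric chR) => //; rewrite xy.
have Rtrans x y z : R x y -> R y z -> R x z.
  (* The least of the three elements is one of them; unless it is [x], antisymmetry identifies two
     of them. *)
  move=> xy yz; have [|t [[tP tmin] _]] := Rwo (pred3 x y z).
    by exists x; rewrite !inE eqxx.
  have [tx ty tz] : [/\ R t x, R t y & R t z].
    by split; apply: tmin; rewrite !inE eqxx ?orbT.
  move: tP; rewrite !inE => /or3P[]/eqP tE; subst t => //.
    by rewrite (Ranti _ _ xy tx).
  by rewrite (Ranti _ _ yz ty) in xy *.
exists (fun x y => ~~ R y x); split=> [x|x y z|x y|P [x Px]].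
- by rewrite Rxx.
- move=> yx zy; apply/negP => zx; have /orP[yz|] := Rtot y z;
    last by rewrite (negbTE zy).
  by move: yx; rewrite (Rtrans _ _ _ yz zx).
- have [xy|] := boolP (R x y); last by constructor 3.
  have [yx|] := boolP (R y x); last by constructor 2.
  by constructor 1; exact: Ranti.
- have [|z [[/set_mem Pz zmin] _]] := Rwo (mem P); first by exists x;
    exact: mem_set.
  by exists z => // y /mem_set Py; rewrite zmin.
Qed.

Section WellOrder.
Variables (T : Type) (lt : T -> T -> Prop).
Hypothesis lt_wo : strict_well_order lt.

Let lt_irr x : ~ lt x x. Proof. by case: lt_wo. Qed.

Let lt_trans x y z : lt x y -> lt y z -> lt x z.
Proof. by case: lt_wo => _ + _ _; apply. Qed.

Let lt_tri x y : [\/ x = y, lt x y | lt y x]. Proof. by case: lt_wo. Qed.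

Let lt_least (P : set T) : P !=set0 ->
  exists2 x, P x & forall y, P y -> ~ lt y x.
Proof. by case: lt_wo => _ _ _; apply. Qed.

Implicit Types A B : set T.

Definition segment B b : set T := [set x | B x /\ lt x b].

Lemma well_order_ind (P : T -> Prop) :
  (forall x, (forall y, lt y x -> P y) -> P x) -> forall x, P x.
Proof.
move=> Pind x; apply: contrapT => nPx.
have [|y nPy ymin] := @lt_least [set z | ~ P z]; first by exists x.
by apply: nPy; apply: Pind => z zy; apply: contrapT => /ymin.
Qed.

Lemma wo_le_lt_trans x y z : ~ lt y x -> lt y z -> lt x z.
Proof. by move=> nyx yz; case: (lt_tri x y) => [->//|xy|//];
  exact: lt_trans yz. Qed.

Lemma wo_lt_le_trans x y z : lt x y -> ~ lt z y -> lt x z.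
Proof. by move=> xy nzy; case: (lt_tri y z) => [<-//|yz|//];
  exact: lt_trans yz. Qed.

Lemma wo_le_le_trans x y z : ~ lt y x -> ~ lt z y -> ~ lt z x.
Proof. by move=> nyx nzy zx; apply: nzy; exact: wo_lt_le_trans zx nyx. Qed.

(* The segments of A below a and of B below b are order isomorphic. *)
Inductive segment_iso A B a b : Prop := SegmentIso of A a & B b &
  (forall a', A a' -> lt a' a -> exists2 b', lt b' b & segment_iso A B a' b') &
  (forall b', B b' -> lt b' b -> exists2 a', lt a' a & segment_iso A B a' b').

(** If [a] matched both [b] and a larger [b'], then [b] would match some [a'] below [a], which in
    turn would match some [c] below [b]: the same situation at [a'], excluded by induction. *)
Lemma segment_iso_fun A B a b b' :
  segment_iso A B a b -> segment_iso A B a b' -> b = b'.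
Proof.
suff nlt : forall a b b', segment_iso A B a b -> segment_iso A B a b' ->
  ~ lt b b'.
  move=> Gb Gb'; case: (lt_tri b b') => [//|bb'|b'b].
    by case: (nlt _ _ _ Gb Gb').
  by case: (nlt _ _ _ Gb' Gb).
move=> {a b b'}; apply: well_order_ind => a IH b b' Gab [_ _ _ Bb'] bb';
  have [_ Bb Ab _] := Gab.
have [a' a'a Ga'b] := Bb' _ Bb bb'; have [Aa' _ _ _] := Ga'b.
have [c cb Ga'c] := Ab _ Aa' a'a; exact: IH a'a _ _ Ga'c Ga'b cb.
Qed.

Lemma segment_iso_inj A B a a' b :
  segment_iso A B a b -> segment_iso A B a' b -> a = a'.
Proof.
have nlt c c' : segment_iso A B c b -> segment_iso A B c' b -> ~ lt c c'.
  move=> Gc [_ _ Ac' _] cc'; have [Ac _ _ _] := Gc.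
  have [b' b'b Gcb'] := Ac' _ Ac cc'.
  by apply: (@lt_irr b); rewrite {1}(segment_iso_fun Gc Gcb').
move=> Ga Ga'; case: (lt_tri a a') => // [aa'|a'a].
  by case: (nlt _ _ Ga Ga').
by case: (nlt _ _ Ga' Ga).
Qed.

(** Comparison of well-orders: at the least [b] of [B] without a partner in [A], the elements of [B]
    below [b] are matched with all of [A]. Thus every cardinal below that of [B] is the size of a
    segment. *)
Lemma card_segment A B : ~ (B #<= A) -> exists2 b, B b & segment B b #= A.
Proof.
move=> nBA; have [|b [Bb nb] bmin] :=
    @lt_least [set b | B b /\ ~ exists a, segment_iso A B a b].
  apply: contrapT => nex; apply: nBA.
  apply: (@card_le_rel _ _ _ _ (fun b a => segment_iso A B a b)).
    move=> b Bb; apply: contrapT => nb; apply: nex; exists b;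
      split=> // -[a Gab].
    by apply: nb; exists a => //; case: Gab.
  by move=> b b' a _ _ _; exact: segment_iso_fun.
exists b => //.
have inran c : B c -> lt c b -> exists a, segment_iso A B a c.
  by move=> Bc cb; apply: contrapT => nc; exact: (bmin c).
have ran a c : segment_iso A B a c -> lt c b.
  move=> Gac; case: (lt_tri c b) => // [cb|bc].
    by case: nb; exists a; rewrite -cb.
  by case: Gac => _ _ _ /(_ _ Bb bc)[a' _ Ga']; case: nb; exists a'.
have dom a : A a -> exists c, segment_iso A B a c.
  move=> Aa; apply: contrapT => na.
  have [|{}a [{}Aa {}na] amin] :=
    @lt_least [set a | A a /\ ~ exists c, segment_iso A B a c];
      first by exists a.
  apply: nb; exists a; split=> // [a' Aa' a'a|b' Bb' b'b].
    have [c Ga'c] : exists c, segment_iso A B a' c.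
      by apply: contrapT => na'; exact: (amin a').
    by exists c => //; exact: ran Ga'c.
  have [a' Ga'b'] := inran _ Bb' b'b; exists a' => //.
  case: (lt_tri a' a) => // [a'a|aa'].
    by case: na; exists b'; rewrite -a'a.
  by case: Ga'b' => _ _ /(_ _ Aa aa')[c _ Gac] _; case: na; exists c.
rewrite card_eq_le; apply/andP; split.
  apply: (@card_le_rel _ _ _ _ (fun b a => segment_iso A B a b)).
    by move=> c [Bc /(inran _ Bc)[a Gac]]; exists a => //; case: Gac.
  by move=> c c' a _ _ _; exact: segment_iso_fun.
apply: (@card_le_rel _ _ _ _ (segment_iso A B)); last first.
  by move=> a a' c _ _ _; exact: segment_iso_inj.
move=> a /dom[c Gac]; exists c => //; split; first by case: Gac.
exact: ran Gac.
Qed.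

(** The counterpart of an initial ordinal: cutting [B] at the least [b] whose segment is as large as
    [B] keeps the cardinality and makes all segments smaller. *)
Lemma small_segments B : exists C, [/\ C `<=` B, C #= B &
  forall c, C c -> ~ (C #<= segment C c)].
Proof.
have [[b0 [Bb0 Bseg]]|nex] := pselect (exists b, B b /\ B #<= segment B b);
  last first.
  by exists B; split=> // c Bc Bseg; apply: nex; exists c.
have [|b [Bb bseg] bmin] := @lt_least [set b | B b /\ B #<= segment B b].
  by exists b0.
exists (segment B b); split=> [x []//||c [Bc cb] Bc'].
  by rewrite card_eq_le bseg andbT; apply: subset_card_le => x [].
apply: (bmin c) => //; split=> //; apply: card_le_trans bseg _.
apply: card_le_trans Bc' _.
by apply: subset_card_le => x [[Bx _] xc].
Qed.

End WellOrder.

(** * Constructions *)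

Section Constructions.
Variables (K : fieldType) (V : lmodType K).
Implicit Types (B S W X Y Z F : set V).

(** For [x] in [X] outside [W1] and [y] in [X] inside it, [x + y] is outside [W1]; so both [x] and
    [x + y] are in [W2], and with them [y]. *)
Lemma subspace_setU W1 W2 X : lin_subspace W1 -> lin_subspace W2 ->
  lin_subspace X -> X `<=` W1 `|` W2 -> X `<=` W1 \/ X `<=` W2.
Proof.
move=> sub1 sub2 subX X12; have [|/existsNP[x /not_implyP[Xx n1x]]] :=
  pselect (X `<=` W1); first by left.
have W2x : W2 x by have [] := X12 _ Xx.
right=> y Xy; have [W1y|//] := X12 _ Xy.
have [W1xy|W2xy] := X12 _ (lin_subspaceD subX Xx Xy).
  by case: n1x; rewrite -(addrK y x); exact: lin_subspaceB.
by rewrite -(addKr x y) addrC; exact: lin_subspaceB.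
Qed.

Lemma lineability_subspace W : lin_subspace W ->
  homogeneous_lineability_number W = cardinal_succ (lin_dim W) /\
  lineability_number W = cardinal_succ (lin_dim W).
Proof.
move=> subW; have := @lineability_bigcup K V [set W] W (cardinal_succ (lin_dim W)).
rewrite bigcup_set1; apply=> //.
- by move=> _ ->.
- by move=> X _ XW; exists W.
- by move=> _ ->.
- by move=> _ ->; left.
- by move=> _ ->; exact: cardinal_lt_succ.
- by move=> m /cardinal_lt_succP; exists W.
Qed.

(** The smaller subspace is spanned by a set [E] of size [l] through [v], which is possible as [l]
    is positive. Since [v] is not in the span of [C], the span of [E] is maximal in the union
    although its dimension is smaller. *)
Lemma lineability_two_subspaces (C : set V) v l :
  lin_indep (v |` C) -> ~ C v -> cardinal_of void < l -> l < cardinal_of C ->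
  exists F : set V, homogeneous_lineability_number F = cardinal_succ l /\
    lineability_number F = cardinal_succ (cardinal_of C).
Proof.
move=> indvC nCv l0 lC; have [T [D lE]] := cardinal_of_set l.
have [|||E [vE EvC ED]] := @card_intermediate _ _ [set v] (v |` C) D.
- by move=> _ ->; left.
- have [d Dd] : D !=set0 by apply/cardinal_gt0P; rewrite -lE.
  rewrite (card_le_trans _ (subset_card_le (_ : [set d] `<=` D)))//;
    last by move=> _ ->.
  by have := eq_card1 v d; rewrite card_eq_le => /andP[].
- apply: (@card_le_trans _ _ _ C); last by apply: subset_card_le; right.
  by apply/cardinal_of_leP; rewrite -lE; exact: cardinal_ltW.
have indC : lin_indep C by apply: lin_indep_sub indvC; right.
have indE : lin_indep E by exact: lin_indep_sub indvC.
have dimE : lin_dim (lin_span E) = l.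
  by rewrite lin_dim_span // lE; apply/cardinal_of_eqP.
have dimC := lin_dim_span indC.
have sub1 := lin_subspace_span E; have sub2 := lin_subspace_span C.
pose Ws : set (set V) := [set lin_span E; lin_span C].
exists (\bigcup_(W in Ws) W); rewrite -dimE -dimC.
apply: lineability_bigcup.
- by move=> _ [] ->.
- by left.
- move=> X subX XW; have [|X1|X2] := subspace_setU sub1 sub2 subX.
  + by move=> x /XW[W [] -> Wx]; [left|right].
  + by exists (lin_span E) => //; left.
  + by exists (lin_span C) => //; right.
- move=> _ [] -> // EC; exfalso.
  have /lin_indep_notin_span : (v |` C) v by left.
  move=> /(_ indvC); apply; apply: (@lin_span_mono _ _ C).
    by move=> x Cx; split; [right|move=> xv; apply: nCv; rewrite -xv].
  by apply/EC/sub_lin_span/vE.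
- move=> _ [] ->; first by left.
  by right; rewrite dimE dimC; exact: cardinal_ltW.
- move=> _ [] ->; last exact: cardinal_lt_succ.
  by apply/cardinal_lt_succP; rewrite dimE dimC; exact: cardinal_ltW.
- by move=> m /cardinal_lt_succP; exists (lin_span C) => //; right.
Qed.

Lemma lineability_successor l m : cardinal_of void < l -> l < m ->
  m <= lin_dim [set: V] ->
  (lin_dim [set: V] < cardinal_of nat -> m < lin_dim [set: V]) ->
  exists F : set V, homogeneous_lineability_number F = cardinal_succ l /\
    lineability_number F = cardinal_succ m.
Proof.
have [B bB] := lin_basis_exists (@lin_subspaceT K V); have [indB _] := bB.
rewrite (lin_dimE bB) => l0 lm mB finB.
suff [C [v [CB Bv nCv mE]]] :
    exists C v, [/\ C `<=` B, B v, ~ C v & m = cardinal_of C].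
  rewrite mE in lm *; apply: (@lineability_two_subspaces _ v) => //.
  by apply: lin_indep_sub indB => w [->|/CB].
have [C CB mE] := cardinal_le_set mB.
have [BC|/existsNP[v /not_implyP[Bv nCv]]] := pselect (B `<=` C); last first.
  by exists C, v.
have {CB BC}CB : C = B by apply/seteqP.
(* Here [m] is the dimension of V and leaves no spare basis vector. The hypothesis [finB] forces
   this dimension to be infinite, so a vector [v] can be taken out of [B] without changing the
   cardinality. *)
have infB : infinite_set B.
  move=> finB'; have [_] : m < cardinal_of B.
    apply: finB; split.
      apply/cardinal_leP; rewrite (card_le_eql (card_setT B)).
      exact: finite_set_countable.
    move=> /cardinal_ofP; rewrite (card_eql (card_setT B)) => BN.
    by apply: infinite_nat; rewrite -(eq_finite_set BN).
  by rewrite mE CB.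
have [v Bv] := infinite_setN0 infB.
exists (B `\ v), v; split=> [x []//|//||].
  by move=> [_]; apply.
by rewrite mE CB; apply/cardinal_of_eqP/card_esym/card_setD1_infinite.
Qed.

(** A finite cardinal n+1 is not a limit: the successor of n would be a natural number strictly
    between n and n+1. *)
Lemma infinite_limit (T : Type) (B : set T) : B !=set0 ->
  (forall m, m < cardinal_of B -> cardinal_succ m < cardinal_of B) ->
  infinite_set B.
Proof.
move=> [b Bb] limB [n Bn].
have kE : cardinal_of B = cardinal_of `I_n by apply/cardinal_of_eqP.
case: n => [|n] in Bn kE *.
  by move: Bn; rewrite II0 card_eq0 => /eqP B0; rewrite B0 in Bb.
have IP i j : cardinal_of `I_i < cardinal_of `I_j -> (i < j)%N.
  move=> /cardinal_ltNge ji; rewrite ltnNge; apply/negP => ji'; apply: ji.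
  by apply/cardinal_of_leP; rewrite card_le_II.
have nS : cardinal_of `I_n < cardinal_of `I_n.+1.
  split; first by apply/cardinal_of_leP; rewrite card_le_II.
  by move=> /cardinal_of_eqP/card_eq_II/n_Sn.
rewrite kE in limB; have sS := limB _ nS.
have [A AI sE] := cardinal_le_set (cardinal_ltW sS).
have [j Aj] : finite_set A by apply: sub_finite_set AI _; exact: finite_II.
have sj : cardinal_succ (cardinal_of `I_n) = cardinal_of `I_j.
  by rewrite sE; apply/cardinal_of_eqP.
have := cardinal_lt_succ (cardinal_of `I_n); rewrite sj => /IP nj.
by move: sS; rewrite sj => /IP; rewrite ltnS leqNgt nj.
Qed.

Section WellOrderedBasis.
Variables (lt : V -> V -> Prop) (B : set V).
Hypothesis lt_wo : strict_well_order lt.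

Let lt_irr x : ~ lt x x. Proof. by case: lt_wo. Qed.

Let lt_trans x y z : lt x y -> lt y z -> lt x z.
Proof. by case: lt_wo => _ + _ _; apply. Qed.

Let lt_tri x y : [\/ x = y, lt x y | lt y x]. Proof. by case: lt_wo. Qed.

Let lt_least (P : set V) : P !=set0 ->
  exists2 x, P x & forall y, P y -> ~ lt y x.
Proof. by case: lt_wo => _ _ _; apply. Qed.

Hypothesis indB : lin_indep B.

(* b is the least element of B occurring in the expansion of x along B. *)
Definition lead (x b : V) : Prop :=
  lin_span [set y | B y /\ ~ lt y b] x /\ ~ lin_span [set y | B y /\ lt b y] x.

Lemma lead_exists S x : S `<=` B -> lin_span S x -> x <> 0%R ->
  exists b, [/\ S b, lin_span [set y | S y /\ ~ lt y b] x & lead x b].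
Proof.
move=> SB Sx x0; have [s [sB sP]] := lin_support indB (lin_span_mono SB Sx).
have sS : [set` s] `<=` S by apply/sP.
have [|b bs bmin] := @lt_least [set` s].
  apply: contrapT => s0; apply: x0; suff : lin_span set0 x by rewrite lin_span0.
  by apply/sP => // y ys; case: s0; exists y.
exists b; split; first exact: sS.
  by apply/sP => [y [/SB]//|y ys]; split; [exact: sS|exact: bmin].
split; first by apply/sP => [y []//|y ys]; split; [exact: sB|exact: bmin].
have sub : [set y | B y /\ lt b y] `<=` B by move=> y [].
by move=> /(sP _ sub)/(_ b bs)[_ /lt_irr].
Qed.

Lemma span_gt_ge b b' : lt b b' ->
  lin_span [set y | B y /\ ~ lt y b'] `<=` lin_span [set y | B y /\ lt b y].
Proof.
move=> bb'; apply: lin_span_mono => y [By yb']; split=> //.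
exact: (wo_lt_le_trans lt_wo) bb' yb'.
Qed.

Lemma lead_fun x b b' : lead x b -> lead x b' -> b = b'.
Proof.
move=> [gb ngb] [gb' ngb']; case: (lt_tri b b') => // [bb'|b'b].
  by case: ngb; exact: (span_gt_ge bb').
by case: ngb'; exact: (span_gt_ge b'b).
Qed.

(* Let b be the least leading element of the vectors of X and x of leading
   element b: then x and x + y both lie in span (I b) for every y in X of a
   larger leading element. *)
Lemma subspace_sub_span (I : V -> set V) X : B !=set0 ->
  (forall b, B b -> I b `<=` B) ->
  (forall b c x, B b -> I b c -> I b x -> ~ lt x c -> I c x) ->
  lin_subspace X -> X `<=` \bigcup_(b in B) lin_span (I b) ->
  exists2 b, B b & X `<=` lin_span (I b).
Proof.
move=> [b0 Bb0] IB Imono subX XI.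
have leadX y : X y -> y <> 0%R -> exists2 b, B b & lead y b.
  move=> /XI[c Bc cy] y0.
  by have [b [/(IB _ Bc) Bb _ ?]] := lead_exists (IB _ Bc) cy y0; exists b.
(* [y] lies in the span of some [I c] that contains [b], and only elements from [b] on occur in [y];
   by [Imono] these belong to [I b]. *)
have Ilead y b : X y -> B b -> lead y b -> lin_span (I b) y.
  move=> Xy Bb yb; have [->|y0] := pselect (y = 0%R).
    exact: lin_subspace0 (lin_subspace_span _).
  have [c Bc cy] := XI _ Xy.
  have [b' [cb' b'y yb']] := lead_exists (IB _ Bc) cy y0.
  rewrite (lead_fun yb yb'); apply: lin_span_mono b'y => z [cz zb'].
  exact: Imono Bc cb' cz zb'.
have [X0|/existsNP[y1 /not_implyP[Xy1 y10]]] := pselect (forall y, X y ->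
  y = 0%R).
  exists b0 => // y /X0 ->; exact: lin_subspace0 (lin_subspace_span _).
have [|b [Bb [x Xx xb]] bmin] :=
  @lt_least [set b | B b /\ exists2 x, X x & lead x b].
  by have [b Bb yb] := leadX _ Xy1 y10; exists b; split=> //; exists y1.
exists b => // y Xy; have [->|y0] := pselect (y = 0%R).
  exact: lin_subspace0 (lin_subspace_span _).
have [b' Bb' yb'] := leadX _ Xy y0.
case: (lt_tri b b') => [bb'|bb'|b'b]; first by apply: Ilead; rewrite // bb'.
  have gy := span_gt_ge bb' yb'.1.
  have gge : lin_span [set y | B y /\ lt b y] `<=` lin_span [set y | B y /\ ~ lt y b].
    apply: lin_span_mono => z [Bz bz]; split=> // zb;
      exact: lt_irr (lt_trans bz zb).
  have xyb : lead (x + y)%R b.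
    split; first by apply: lin_subspaceD (lin_subspace_span _) _ _ xb.1 (gge _ gy).
    move=> gxy; apply: xb.2; rewrite -(addrK y x).
    exact: lin_subspaceB (lin_subspace_span _) _ _ gxy gy.
  have := Ilead _ _ (lin_subspaceD subX Xx Xy) Bb xyb.
  move=> Ixy; rewrite -(addKr x y) addrC.
  exact: lin_subspaceB (lin_subspace_span _) _ _ Ixy (Ilead _ _ Xx Bb xb).
by case: (bmin b'); first by split=> //; exists y.
Qed.

End WellOrderedBasis.

(* B is a basis of cardinality k, well-ordered so that its segments are smaller
   than k, and b0 cuts off a segment of cardinality l. The intervals I b are
   [b, b0) for b < b0 and otherwise [b, c) for the least c for which [b, c)
   is larger than the segment below b. The subspaces spanned by them have
   dimensions cofinal in k, the one of the first interval is maximal in their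
   union and has dimension l, and those not inside it have larger dimension. *)
Lemma lineability_limit l k : cardinal_of void < l -> l < k ->
  k <= lin_dim [set: V] -> (forall m, m < k -> cardinal_succ m < k) ->
  exists F : set V, homogeneous_lineability_number F = cardinal_succ l /\
    lineability_number F = k.
Proof.
move=> l0 lk kV limk; have [D bD] := lin_basis_exists (@lin_subspaceT K V).
move: kV; rewrite (lin_dimE bD) => /cardinal_le_set[D' D'D kD'].
have [lt lt_wo] := strict_well_order_exists V.
have [lt_irr lt_trans lt_tri lt_least] := lt_wo.
have [B [BD' BD'card Bseg]] := small_segments lt_wo D'.
have {BD'card kD'}kB : k = cardinal_of B.
  by rewrite kD'; apply/cardinal_of_eqP/card_esym.
have indB : lin_indep B.
  by apply: lin_indep_sub bD.1; exact: subset_trans BD' D'D.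
have ltkP (A : set V) : cardinal_of A < k <-> ~ (B #<= A).
  by rewrite kB cardinal_ltNge cardinal_of_leP.
have B0 : B !=set0.
  apply/cardinal_gt0P; rewrite -kB; apply: cardinal_le_lt_trans lk.
  exact: cardinal_ge0.
have infB : infinite_set B by apply: infinite_limit B0 _; rewrite -kB.
have segE m (C : set V) : m < cardinal_of C ->
    exists2 c, C c & cardinal_of (segment lt C c) = m.
  move=> mC; have [A AC mA] := cardinal_le_set (cardinal_ltW mC).
  have [|c Cc cA] := card_segment lt_wo (A := A) (B := C).
    by move: mC; rewrite mA cardinal_ltNge cardinal_of_leP.
  by exists c => //; rewrite mA; apply/cardinal_of_eqP.
have [b0 Bb0 b0l] : exists2 c, B c & cardinal_of (segment lt B c) = l.
  by apply: segE; rewrite -kB.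
pose tail b := [set x | B x /\ ~ lt x b].
pose I b := [set x | [/\ B x, ~ lt x b & if `[< lt b b0 >] then lt x b0 else
  segment lt (tail b) x #<= segment lt B b]].
have IB b : B b -> I b `<=` B by move=> _ x [].
(* Moving the left end from [b] up to [c] shrinks the interval up to [x] and enlarges the segment to
   which it is compared, so [x] is kept. *)
have Imono b c x : B b -> I b c -> I b x -> ~ lt x c -> I c x.
  move=> Bb [Bc cb] + [Bx xb] + xc.
  case: asboolP => [bb0|bb0] cb0 xb0; split=> //; case: asboolP => // cb0'.
    by case: bb0; exact: (wo_le_lt_trans lt_wo) cb cb0'.
  apply: card_le_trans (subset_card_le _) (card_le_trans xb0 (subset_card_le _)).
    move=> y [[By yc] yx]; split=> //; split=> //.
    exact: (wo_le_le_trans lt_wo cb yc).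
  by move=> y [By yb]; split=> //; exact: (wo_lt_le_trans lt_wo yb cb).
have large b : B b -> ~ lt b b0 ->
    cardinal_of (segment lt B b) < cardinal_of (I b) /\ cardinal_of (I b) < k.
  move=> Bb bb0.
  have nuk : cardinal_of (segment lt B b) < k by apply/ltkP; exact: Bseg.
  have [c [Tc cnu]] : exists c, tail b c /\
      cardinal_of (segment lt (tail b) c) =
        cardinal_succ (cardinal_of (segment lt B b)).
    have [|c Tc cE] := segE (cardinal_succ (cardinal_of (segment lt B b))) (tail b); last first.
      by exists c.
    (* As [k] is a limit, a tail no larger than this successor would be smaller than [k]; but two
       sets smaller than the infinite [B] cannot cover it. *)
    apply/cardinal_ltNge => Tnu.
    have Tk : cardinal_of (tail b) < k.
      by apply: cardinal_le_lt_trans Tnu (limk _ nuk).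
    apply: (@card_setU_lt _ _ B (segment lt B b) (tail b)) => //.
    - exact/ltkP.
    - exact/ltkP.
    - apply: subset_card_le => x Bx.
      by have [xb|xb] := pselect (lt x b); [left|right].
  have [|d [Td dnu] dmin] := @lt_least [set d | tail b d /\
      ~ (segment lt (tail b) d #<= segment lt B b)].
    exists c; split=> //; apply/(cardinal_of_leP _ _)/cardinal_ltNge;
      rewrite cnu.
    exact: cardinal_lt_succ.
  have IbE : I b = segment lt (tail b) d.
    apply/seteqP; split=> x.
      move=> [Bx xb]; case: asboolP => // _ xnu; split=> //.
      case: (lt_tri x d) => // [xd|dx]; first by case: dnu; rewrite -xd.
      case: dnu; apply: card_le_trans xnu; apply: subset_card_le => y [Ty yd].
      by split=> //; exact: lt_trans dx.
    move=> [[Bx xb] xd]; split=> //; case: asboolP => // _.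
    by apply: contrapT => xnu; apply: (dmin x).
  rewrite IbE; split; first by apply/cardinal_ltNge => /cardinal_of_leP.
  have [Bd _] := Td; apply: cardinal_le_lt_trans (_ : cardinal_of (segment lt B d) < k).
    by apply/cardinal_of_leP/subset_card_le => x [[Bx _] xd].
  by apply/ltkP; exact: Bseg.
(* The first interval starts at the least element [m] of [B]. As [l] is positive, [m] is below [b0],
   so this interval is the whole segment below [b0]. *)
have [m Bm mmin] := lt_least B B0.
have mb0 : lt m b0.
  have /cardinal_gt0P[x [Bx xb0]] : cardinal_of void < cardinal_of (segment lt B b0).
    by rewrite b0l.
  exact: (wo_le_lt_trans lt_wo) (mmin _ Bx) xb0.
have Im : I m = segment lt B b0.
  apply/seteqP; split=> [x [Bx _]|x [Bx xb0]]; first by case: asboolP.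
  by split=> //; [exact: mmin|case: asboolP].
have dimI b : B b -> lin_dim (lin_span (I b)) = cardinal_of (I b).
  by move=> Bb; apply: lin_dim_span; exact: lin_indep_sub (IB _ Bb) indB.
have dimIm : lin_dim (lin_span (I m)) = l by rewrite dimI // Im.
have Ism b : lt b b0 -> I b `<=` I m.
  by move=> bb0 x [Bx xb]; rewrite Im; case: asboolP.
pose Ws : set (set V) := [set lin_span (I b) | b in B].
exists (\bigcup_(W in Ws) W); rewrite -dimIm; apply: lineability_bigcup.
- by move=> _ [b _ <-]; exact: lin_subspace_span.
- by exists m.
- move=> X subX; rewrite bigcup_image => XI.
  have [b Bb Xb] := subspace_sub_span lt_wo indB B0 IB Imono subX XI.
  by exists (lin_span (I b)) => //; exists b.
(* The interval [I m] is the only one containing [m], so its span is inside no other. *)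
- move=> _ [b Bb <-] mb; suff -> : b = m by [].
  apply: contrapT => bm; apply: (lin_indep_notin_span indB Bm).
  apply: (@lin_span_mono _ _ (I b)); last first.
    by apply/mb/sub_lin_span; rewrite Im.
  move=> x [Bx xb _]; split=> // xm; rewrite xm in xb.
  by case: (lt_tri b m) => // bm'; exact: (mmin b).
- move=> _ [b Bb <-]; have [bb0|bb0] := pselect (lt b b0).
    by left; apply: lin_span_mono; exact: Ism.
  right; rewrite dimIm dimI // -b0l; apply: cardinal_ltW.
  apply: cardinal_le_lt_trans (large _ Bb bb0).1.
  apply/cardinal_of_leP/subset_card_le => x [Bx xb0]; split=> //.
  exact: (wo_lt_le_trans lt_wo) xb0 bb0.
- move=> _ [b Bb <-]; rewrite dimI //; have [bb0|bb0] := pselect (lt b b0).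
    apply: cardinal_le_lt_trans lk; rewrite -b0l -Im; apply/cardinal_of_leP.
    by apply: subset_card_le; exact: Ism.
  exact: (large _ Bb bb0).2.
- move=> n nk; have [c Bc cn] : exists2 c, B c & cardinal_of (segment lt B c) = n.
    by apply: segE; rewrite -kB.
  have [cb0|cb0] := pselect (lt c b0).
    exists (lin_span (I m)); first by exists m.
    rewrite dimI // -cn Im; apply/cardinal_of_leP/subset_card_le => x [Bx xc].
    by split=> //; exact: lt_trans xc cb0.
  exists (lin_span (I c)); first by exists c.
  by rewrite dimI // -cn; apply: cardinal_ltW; exact: (large _ Bc cb0).1.
Qed.

End Constructions.

(* The last two hypotheses of the third clause exclude exactly the degenerate *)
(* cases l = 0, and dim V finite with k = dim V + 1, in which no F exists: in *)
(* the first HL F = 1 forces L F = 1, in the second L F = k forces F to be    *)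
(* all of V up to the zero vector, hence HL F = k.                            *)
Theorem proposition2p4 (K : fieldType) (V : lmodType K) :
  let dimV := lin_dim [set: V] in
  let HL := @homogeneous_lineability_number K V in
  let L := @lineability_number K V in
  [/\ forall F : set V, HL F <= L F,
      forall k : cardinal, successor_cardinal k -> k <= cardinal_succ dimV ->
        exists F : set V, HL F = k /\ L F = k,
      forall l k : cardinal,
        l <= cardinal_succ dimV -> k <= cardinal_succ dimV ->
        cardinal_succ l < k ->
        cardinal_of void < l -> (dimV < cardinal_of nat -> k <= dimV) ->
        exists F : set V, HL F = cardinal_succ l /\ L F = k
    & forall F : set V, successor_cardinal (HL F)].
Proof.
move=> dimV HL L; split.
- exact: homogeneous_lineability_le_lineability.
- move=> _ [m ->] /cardinal_succ_le/cardinal_lt_succP mV.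
  have [|W [subW _ _ <-]] := lin_intermediate (@lin_subspace_set0 K V)
      (@lin_subspaceT K V) (@subsetT _ _) _ mV.
  + by rewrite lin_dim_set0; exact: cardinal_ge0.
  + by exists W; exact: lineability_subspace.
- move=> l k _ kV lk l0 finV.
  have [[m [mk km]]|limk] := pselect (exists m, m < k /\ k <= cardinal_succ m).
    have {km}kE : k = cardinal_succ m.
      by apply: cardinal_le_anti km _; exact/cardinal_succ_le.
    rewrite {}kE in lk kV finV *; apply: lineability_successor => //.
    + exact/cardinal_succ_le/cardinal_lt_succP.
    + exact/cardinal_lt_succP/cardinal_succ_le.
    + by move=> /finV/cardinal_succ_le.
  have {}limk m : m < k -> cardinal_succ m < k.
    by move=> mk; apply/cardinal_ltNge => km; apply: limk; exists m.
  apply: lineability_limit => //.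
    exact: cardinal_le_lt_trans (cardinal_ltW (cardinal_lt_succ l)) lk.
  (* If the dimension of V were below the limit [k], so would be its successor, against [kV]. *)
  apply/cardinal_leNgt => /limk; apply/cardinal_leNgt.
  exact: kV.
- by move=> F; have [Z _ HLE] := homogeneous_lineabilityE F; exists (lin_dim Z).
Qed.
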